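(* Let $X$ be a real Banach space, let $f:[a,b]\to X$ and $x\in[a,b]$ be such that $md(f,x)$ exists, but $f$ is not metrically differentiable at $x$. If $h$ is a homeomorphism of $[a,b]$ onto itself such that $f\circ h$ is metrically differentiable at $h^{-1}(x)$, then $md(f\circ h,h^{-1}(x))=0$.
   Context: For $f:[a,b]\to X$, the unilateral metric derivatives are $md_{\pm}(f,x)=\lim_{t\to0+}\frac{\|f(x\pm t)-f(x)\|}{t}$. If both exist and are equal (and finite), their common value is the metric derivative $md(f,x)$; at an endpoint of $[a,b]$ only the one-sided limit taken inside $[a,b]$ is used. The mapping $f$ is metrically differentiable at $x$ if $md(f,x)$ exists and $\|f(y)-f(z)\|-md(f,x)|y-z|=o(|y-x|+|z-x|)$ as $(y,z)\to(x,x)$ with $y,z\in[a,b]$. *)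

(* Defs.v *)
From HB Require Import structures.
From mathcomp Require Import all_boot all_order all_algebra.
From mathcomp Require Import all_classical all_reals all_analysis.

Set Implicit Arguments.
Unset Strict Implicit.
Unset Printing Implicit Defensive.

Import Order.TTheory GRing.Theory Num.Theory.
Import numFieldNormedType.Exports.

Local Open Scope classical_set_scope.
Local Open Scope ring_scope.

(* A map [a, b] -> X is given by a total function f : R -> X; for x in [a, b]  *)
(* nothing below depends on the values of f outside [a, b].                   *)

Definition is_md_right (R : realType) (X : normedModType R)
    (f : R -> X) (x l : R) : Prop :=
  `|f (x + t) - f x| / t @[t --> 0^'+] --> l.

Definition is_md_left (R : realType) (X : normedModType R)
    (f : R -> X) (x l : R) : Prop :=
  `|f (x - t) - f x| / t @[t --> 0^'+] --> l.

(* "md(f, x) exists and equals l", for x in [a, b] and a < b. At an endpoint  *)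
(* one of the two conditions is void.                                         *)
Definition is_md (R : realType) (X : normedModType R) (a b : R)
    (f : R -> X) (x l : R) : Prop :=
  (x < b -> is_md_right f x l) /\ (a < x -> is_md_left f x l).

Definition metrically_differentiable (R : realType) (X : normedModType R)
    (a b : R) (f : R -> X) (x : R) : Prop :=
  exists2 l : R, is_md a b f x l &
    (fun p : R * R => `|f p.1 - f p.2| - l * `|p.1 - p.2|)
    =o_ (within (`[a, b] `*` `[a, b]) (nbhs (x, x)))
    (fun p : R * R => `|p.1 - x| + `|p.2 - x|).

(* h restricts to a homeomorphism of A onto B, with inverse pinv A h. *)
Definition homeomorphism_on (T U : ptopologicalType) (A : set T) (B : set U)
    (h : T -> U) : Prop :=
  [/\ set_bij A B h, {within A, continuous h}
    & {within B, continuous (pinv A h)}].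

(* Main.v *)
Require Import Defs.
From HB Require Import structures.
From mathcomp Require Import all_boot all_order all_algebra.
From mathcomp Require Import all_classical all_reals all_analysis.
From mathcomp Require Import ring lra.

Set Implicit Arguments.
Unset Strict Implicit.
Unset Printing Implicit Defensive.

Import Order.TTheory GRing.Theory Num.Theory.
Import numFieldNormedType.Exports.
Local Open Scope classical_set_scope.
Local Open Scope ring_scope.

(** Let [y = h^-1 x], [m = md (f, x)] and [l = md (f \o h, y)].  If [m = 0],
    then [f] is metrically differentiable at [x] by the triangle inequality,
    so [m > 0].  If moreover [l > 0], comparing
    [|f (h u) - f x| ~ l |u - y|] with [|f (h u) - f x| ~ m |h u - x|] and using
    that [h] is strictly monotone shows that [h] is differentiable at [y] with
    derivative [± l / m].  Hence [l |u - v| - m |h u - h v|] is negligible, and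
    the metric differentiability of [f \o h] at [y] transfers to [f] at [x],
    a contradiction. *)

(** Clearing the denominator [t] in each one-sided limit gives the bound on that side of [x], and
    [z = x] is trivial. At an endpoint the void side contains no point of [[a, b]], so any radius
    serves there. *)
Lemma is_md_dist (R : realType) (X : normedModType R) (a b : R) (f : R -> X)
    (x l : R) : is_md a b f x l ->
  forall e, 0 < e -> exists2 d, 0 < d & forall z, z \in `[a, b] ->
    `|z - x| < d -> `| `|f z - f x| - l * `|z - x| | <= e * `|z - x|.
Proof.
have unscale (t r e : R) : 0 < t -> `|l - r / t| <= e -> `|r - l * t| <= e * t.
  move=> t0 le_e; have -> : r - l * t = - ((l - r / t) * t).
    by field; rewrite gt_eqF.
  by rewrite normrN normrM (gtr0_norm t0) ler_wpM2r// ltW.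
move=> [hr hl] e e0.
have [d1 d10 h1] : exists2 d, 0 < d & forall z, z \in `[a, b] -> x < z ->
    `|z - x| < d -> `| `|f z - f x| - l * `|z - x| | <= e * `|z - x|.
  have [xb|bx] := ltP x b; last first.
    by exists 1 => // z /itvP zab xz; rewrite ltNge (le_trans _ bx) ?zab in xz.
  have /cvgrPdist_le/(_ e e0)/nbhs_ballP[d /= d0 hd] := hr xb.
  exists d => // z zab xz; rewrite gtr0_norm ?subr_gt0// => zd.
  apply: unscale; first by rewrite subr_gt0.
  have := hd (z - x); rewrite subrKC; apply; last by rewrite subr_gt0.
  by rewrite /ball/= sub0r normrN gtr0_norm ?subr_gt0.
have [d2 d20 h2] : exists2 d, 0 < d & forall z, z \in `[a, b] -> z < x ->
    `|z - x| < d -> `| `|f z - f x| - l * `|z - x| | <= e * `|z - x|.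
  have [ax|xa] := ltP a x; last first.
    by exists 1 => // z /itvP zab zx; rewrite ltNge (le_trans xa) ?zab in zx.
  have /cvgrPdist_le/(_ e e0)/nbhs_ballP[d /= d0 hd] := hl ax.
  exists d => // z zab zx; rewrite distrC gtr0_norm ?subr_gt0// => zd.
  apply: unscale; first by rewrite subr_gt0.
  have := hd (x - z); rewrite subKr; apply; last by rewrite subr_gt0.
  by rewrite /ball/= sub0r normrN gtr0_norm ?subr_gt0.
exists (Num.min d1 d2); first by rewrite lt_min d10.
move=> z zab; rewrite lt_min => /andP[zd1 zd2].
have [zx|xz|->] := ltgtP z x; [exact: h2|exact: h1|].
by rewrite !subrr !normr0 !mulr0 subrr normr0.
Qed.

(** Since [a < b], at least one of the two one-sided limits is a genuine condition, and it is a
    limit of nonnegative quotients. *)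
Lemma is_md_ge0 (R : realType) (X : normedModType R) (a b : R) (f : R -> X)
    (x l : R) : a < b -> x \in `[a, b] -> is_md a b f x l -> 0 <= l.
Proof.
move=> ab; rewrite in_itv/= => /andP[ax xb] [hr hl].
have sgn0 (g : R -> R) : (forall t, 0 <= g t) ->
    g t / t @[t --> 0^'+] --> l -> 0 <= l.
  move=> g0 gl; rewrite -(cvg_lim _ gl)//; apply: limr_ge; first exact: cvgP gl.
  near=> t; apply: divr_ge0 => //.
have [lt_xb|le_bx] := ltP x b; first exact: sgn0 (hr lt_xb).
by apply: sgn0 (hl _) => //; exact: lt_le_trans le_bx.
Unshelve. all: by end_near. Qed.

Lemma mdiff_oP (R : realType) (X : normedModType R) (a b : R) (f : R -> X)
    (x l : R) :
  (fun p : R * R => `|f p.1 - f p.2| - l * `|p.1 - p.2|)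
    =o_ (within (`[a, b] `*` `[a, b]) (nbhs (x, x)))
    (fun p : R * R => `|p.1 - x| + `|p.2 - x|) <->
  forall e, 0 < e -> exists2 d, 0 < d & forall z w,
    z \in `[a, b] -> w \in `[a, b] -> `|z - x| < d -> `|w - x| < d ->
    `| `|f z - f w| - l * `|z - w| | <= e * (`|z - x| + `|w - x|).
Proof.
split=> [/eqoP ho e e0|ho].
  have /nbhs_ballP[d /= d0 hd] := ho e e0.
  exists d => // z w zab wab zd wd.
  have := hd (z, w); rewrite /= [X in _ <= _ * X]ger0_norm ?addr_ge0//; apply=> //.
  by split; rewrite /ball/= distrC.
apply/eqoP => e e0; have [d d0 hd] := ho e e0.
apply/nbhs_ballP; exists d => // -[z w] [/= zd wd] [/= zab wab].
rewrite [X in _ <= _ * X]ger0_norm ?addr_ge0//.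
by apply: hd => //; rewrite distrC.
Qed.

Lemma within_continuous_dist (R : realType) (A : set R) (g : R -> R) (x : R) :
  {within A, continuous g} -> A x -> forall e, 0 < e ->
  exists2 d, 0 < d & forall z, A z -> `|z - x| < d -> `|g z - g x| < e.
Proof.
move=> /subspace_continuousP/(_ x) gx Ax e e0.
have /cvgrPdist_lt/(_ e e0)/nbhs_ballP[d /= d0 hd] := gx Ax.
exists d => // z Az zd; rewrite distrC; apply: hd => //.
by rewrite /ball/= distrC.
Qed.

(** A continuous injection of an interval is strictly monotone. With [s = 1] in the increasing case
    and [s = -1] in the decreasing one, [s * (h u - h y)] and [u - y] have the same sign. This turns
    an estimate between absolute values into a linear one, and linear estimates at two points can be
    subtracted. *)
Lemma inj_continuous_sign (R : realType) (a b : R) (h : R -> R) (y : R) :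
  {within `[a, b], continuous h} -> set_inj `[a, b] h -> y \in `[a, b] ->
  exists2 s : R, `|s| = 1 & forall u, u \in `[a, b] -> forall m l : R,
    `|s * m * (h u - h y) - l * (u - y)| =
    `|m * `|h u - h y| - l * `|u - y| |.
Proof.
move=> hc hi yab.
have hi' : {in `[a, b] &, injective h}.
  by move=> u v uab vab; apply: hi; rewrite inE.
have [hm|hm] := itv_continuous_inj_mono hc hi'.
- exists 1; first exact: normr1.
  move=> u uab m l; have [uy|yu|->] := ltgtP u y.
  + have := hm _ _ uab yab uy; rewrite -subr_gt0 => huy.
    rewrite (distrC (h u)) (distrC u) (gtr0_norm huy) (gtr0_norm (x := y - u)) ?subr_gt0//.
    by rewrite -[LHS]normrN; congr `|_|; ring.
  + have := hm _ _ yab uab yu; rewrite -subr_gt0 => huy.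
    by rewrite (gtr0_norm huy) (gtr0_norm (x := u - y)) ?subr_gt0// mul1r.
  + by rewrite !subrr !normr0 !mulr0.
- exists (-1); first by rewrite normrN normr1.
  move=> u uab m l; have [uy|yu|->] := ltgtP u y.
  + have := hm _ _ yab uab uy; rewrite -subr_gt0 => huy.
    rewrite (distrC u) (gtr0_norm huy) (gtr0_norm (x := y - u)) ?subr_gt0//.
    by rewrite -[LHS]normrN; congr `|_|; ring.
  + have := hm _ _ uab yab yu; rewrite -subr_gt0 => huy.
    rewrite (distrC (h u)) (gtr0_norm huy) (gtr0_norm (x := u - y)) ?subr_gt0//.
    by congr `|_|; ring.
  + by rewrite !subrr !normr0 !mulr0.
Qed.

Lemma is_md0_mdiff (R : realType) (X : normedModType R) (a b : R) (f : R -> X)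
    (x : R) : is_md a b f x 0 -> metrically_differentiable a b f x.
Proof.
move=> hmd; exists 0 => //; apply/mdiff_oP => e e0.
have [d d0 hd] := is_md_dist hmd e0.
exists d => // z w zab wab zd wd.
have := hd z zab zd; have := hd w wab wd.
rewrite !mul0r !subr0 !normr_id => hw hz.
rewrite mulrDr (le_trans _ (lerD hz hw))// (distrC (f w)).
by rewrite (le_trans _ (ler_normD _ _))// subrKA.
Qed.

Lemma mdiff_comp_homeo (R : realType) (X : normedModType R) (a b : R)
    (f : R -> X) (h : R -> R) (x m l : R) (y := pinv `[a, b] h x) :
  x \in `[a, b] -> homeomorphism_on `[a, b] `[a, b] h ->
  0 < m -> is_md a b f x m ->
  0 < l ->
  (fun p : R * R => `|(f \o h) p.1 - (f \o h) p.2| - l * `|p.1 - p.2|)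
    =o_ (within (`[a, b] `*` `[a, b]) (nbhs (y, y)))
    (fun p : R * R => `|p.1 - y| + `|p.2 - y|) ->
  metrically_differentiable a b f x.
Proof.
move=> xab [hbij hc gc] m0 fm l0 /mdiff_oP fho.
exists m => //; apply/mdiff_oP => e e0.
have [_ hinj hsurj] := hbij.
have hK : {in `[a, b], cancel (pinv `[a, b] h) h}.
  by move=> z zab; apply: (surjpK _ hsurj); rewrite inE.
have gab z : z \in `[a, b] -> pinv `[a, b] h z \in `[a, b].
  by move=> zab; apply: (surjpinv_image_sub hsurj); exists z.
have yab : y \in `[a, b] by exact: gab.
have hy : h y = x by exact: hK.
have [s s1 hs] := inj_continuous_sign hc hinj yab.
(* The bounds [e1 <= l / 2] and [e2 <= m] yield [l * |u - y| <= 4 * m * |z - x|]. The other bound on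
   [e1] then gives [2 * e1 * |u - y| <= e / 2 * |z - x|], and [e2 <= e / 2] covers the remaining
   half. *)
pose e1 := Num.min (l / 2) (e * l / (16 * m)).
pose e2 := Num.min (e / 2) m.
have e10 : 0 < e1 by rewrite lt_min !divr_gt0 ?mulr_gt0.
have e20 : 0 < e2 by rewrite lt_min !divr_gt0.
have [d1 d10 hd1] := fho _ e10.
have [d2 d20 hd2] := is_md_dist fm e20.
have [d3 d30 hd3] := within_continuous_dist gc xab d10.
exists (Num.min d2 d3); first by rewrite lt_min d20.
have e1l : e1 <= l / 2 by rewrite ge_min lexx.
have e1e : 8 * m * e1 <= e * l / 2.
  have : e1 <= e * l / (16 * m) by rewrite ge_min lexx orbT.
  by rewrite ler_pdivlMr ?mulr_gt0//; lra.
have e2e : e2 <= e / 2 by rewrite ge_min lexx.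
have e2m : e2 <= m by rewrite ge_min lexx orbT.
(* The last conjunct is the differentiability of [h] at [y], with derivative [s * l / m], in a form
   free of division. *)
have one z : z \in `[a, b] -> `|z - x| < Num.min d2 d3 ->
    let u := pinv `[a, b] h z in
    [/\ u \in `[a, b], h u = z, `|u - y| < d1, 2 * e1 * `|u - y| <= e / 2 * `|z - x|
      & `|s * m * (z - x) - l * (u - y)| <= e1 * `|u - y| + e2 * `|z - x|].
  move=> zab; rewrite lt_min => /andP[zd2 zd3] u.
  have uab : u \in `[a, b] by exact: gab.
  have hu : h u = z by exact: hK.
  have uy : `|u - y| < d1 by exact: hd3.
  have A := hd1 u y uab yab uy; rewrite subrr normr0 d10 addr0 /= hu hy in A.
  have {}A := A isT; have B := hd2 z zab zd2.
  have := hs u uab m l; rewrite hu hy => ->.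
  split=> //.
    move: A B; rewrite !ler_norml => /andP[A1 A2] /andP[B1 B2].
    have U0 := normr_ge0 (u - y); have T0 := normr_ge0 (z - x).
    (* Both estimates concern [|f z - f x|], so [(l - e1) * |u - y| <= (m + e2) * |z - x|]. *)
    have lU : l * `|u - y| <= 4 * m * `|z - x|.
      have := ler_wpM2r U0 e1l; have := ler_wpM2r T0 e2m; lra.
    rewrite -(ler_pM2l l0).
    have := ler_wpM2l (ltW e10) lU; have := ler_wpM2r T0 e1e; lra.
  rewrite (addrC (e1 * _)) (le_trans _ (lerD B A))//.
  by rewrite (distrC _ (m * _)) ler_distD.
move=> z w zab wab zd wd.
have [] := one z zab zd; have [] := one w wab wd.
set v := pinv _ _ w; set u := pinv _ _ z.
move=> vab hv vy lv Dv uab hu uy lu Du.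
have A := hd1 u v uab vab uy vy; rewrite /= hu hv in A.
(* Subtracting the linear estimates at [z] and [w] cancels [x] and [y]; the reverse triangle
   inequality then restores the absolute values. *)
have B : `|l * `|u - v| - m * `|z - w| | <=
    e1 * `|u - y| + e2 * `|z - x| + (e1 * `|v - y| + e2 * `|w - x|).
  rewrite (le_trans _ (lerD Du Dv))// distrC.
  have -> : m * `|z - w| = `|s * m * (z - w)|.
    by rewrite !normrM s1 mul1r (gtr0_norm m0).
  have -> : l * `|u - v| = `|l * (u - v)| by rewrite normrM (gtr0_norm l0).
  rewrite (le_trans (ler_dist_dist _ _))// (le_trans _ (ler_normB _ _))//.
  rewrite le_eqVlt; apply/orP; left; apply/eqP.
  by congr `|_|; ring.
(* Each of [e1 * |u - y|] and [e1 * |v - y|] occurs once in [A] and once in [B], hence the factor 2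
   in [lu] and [lv]. *)
rewrite (le_trans (ler_distD (l * `|u - v|) _ _))// (le_trans (lerD A B))//.
have := ler_wpM2r (normr_ge0 (z - x)) e2e.
have := ler_wpM2r (normr_ge0 (w - x)) e2e; lra.
Qed.

Theorem lemma5p4 (R : realType) (X : completeNormedModType R) (a b : R)
    (hab : a < b) (f : R -> X) (x : R) (hx : x \in `[a, b])
    (hmd : exists l : R, is_md a b f x l)
    (hnd : ~ metrically_differentiable a b f x)
    (h : R -> R) (hh : homeomorphism_on `[a, b] `[a, b] h)
    (hfh : metrically_differentiable a b (f \o h) (pinv `[a, b] h x)) :
  is_md a b (f \o h) (pinv `[a, b] h x) 0.
Proof.
have [m fm] := hmd; have [l fhl fho] := hfh.
have yab : pinv `[a, b] h x \in `[a, b].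
  by have [[_ _ hsurj] _ _] := hh; apply: (surjpinv_image_sub hsurj); exists x.
have := is_md_ge0 hab hx fm; rewrite le_eqVlt => /predU1P[m0|m0].
  by exfalso; apply: hnd; apply: is_md0_mdiff; rewrite m0.
have := is_md_ge0 hab yab fhl; rewrite le_eqVlt => /predU1P[->//|l0].
by exfalso; apply: hnd; exact: (mdiff_comp_homeo hx hh m0 fm l0 fho).
Qed.
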